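(* Let $\mathbb K$ be a field, $\mathbb P=\mathbb K[x_1,\dots,x_n]$, $f=(f_1,\dots,f_d)\in\mathbb P^d$, and let $\prec_m$ and $\prec_s$ be compatible admissible orders on $\mathbb P$ and $\mathbb P^d$. In the TRB-MJ algorithm with input $f$, every signature of a pair in $DONE$ is either a syzygy signature or a TRB signature.
   Context: Basic notions. $M$ is the set of monomials of $\mathbb P$; a monomial of $\mathbb P^d$ is $mE_i$ with $m\in M$ and $E_i$ the $i$-th unit vector; $s\mid s'$ for monomials of $\mathbb P^d$ means $s'=ms$ for some $m\in M$. $\prec_m$, $\prec_s$ are admissible orders on $\mathbb P$, $\mathbb P^d$ (total orders on monomials compatible with multiplication by $M$, with $1\prec_m m$ for $1\ne m\in M$, resp. $s\prec_s ms$). They are compatible if for all monomials $s_1,s_2$ of $\mathbb P^d$ and $m_1,m_2\in M$, $s_1\preceq_s s_2$ and $m_1\preceq_m m_2$ imply $s_1m_1\preceq_s s_2m_2$, with equality iff $s_1=s_2$ and $m_1=m_2$ (equivalently, restricting $\prec_s$ to each component $\{mE_i\}$ gives $\prec_m$). Conventionally $lm(0)=0$ and $0$ is smaller than every monomial. Leading monomials/terms/coefficients are taken with respect to $\prec_m$ on $\mathbb P$ and $\prec_s$ on $\mathbb P^d$. A pair is $p=(u,v)\in\mathbb P^d\times\mathbb P$ with $u\cdot f=v$; $lm(p)=lm(v)$, $lt(p)=lt(v)$, $sig(p)=lm(u)$. $(u_1,v_1)\prec_p(u_2,v_2)$ iff $lm(v_1)lm(u_2)\prec_s lm(v_2)lm(u_1)$.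 $p_1\equiv p_2$ (equivalent) iff $sig(p_1)=sig(p_2)$ and $lm(p_1)=lm(p_2)$. $p_1\sim p_2$ (similar) iff $lm(p_1)sig(p_2)=lm(p_2)sig(p_1)$. $p$ is syzygy if $lm(p)=0$; a signature is syzygy if it is the signature of a syzygy pair. $p_1$ is top reducible by $p_2$ if both are non-syzygy, $p_1\prec_p p_2$ and $lm(p_2)\mid lm(p_1)$; the top reduction replaces $p_1$ by $p_1-\frac{lt(p_1)}{lt(p_2)}p_2$. A non-syzygy pair that cannot be top reduced by any pair is a TRP pair. The TRP similar set of $p$ is the set of all TRP pairs similar to $p$. A TRB pair is a TRP pair $p'$ such that $sig(p')$ is not properly divisible by any signature of a pair in the same TRP similar set; a TRB signature is the signature of a TRB pair. Multiplied pairs. A multiplied pair $[m,p]$ is an element of $M\times PAIR$ ($PAIR$ the set of all pairs); its value is $mp$ and $sig([m,p])=sig(mp)$; ''signed $s$'' means having signature $s$. For two non-similar non-syzygy pairs $p_1,p_2$, their J-pair is $[m,p]$ with $p$ the $\prec_p$-smaller of $p_1,p_2$ and $m=lcm(lm(p_1),lm(p_2))/lm(p)$. For a set $PS$ of pairs, $[m_0,p_0]\in M\times PS$ is an M-pair of $PS$ signed $s$ if $s=sig(m_0p_0)$, $m_0\neq1$, and for all $[m,p]\in M\times PS$ signed $s$ with $m\neq 1$ and $p\not\equiv p_0$ one has $p_0\prec_p p$, or $p_0\sim p$ and $sig(p_0)\succ_s sig(p)$. TRB-MJ algorithm. Step 0: $DONE:=\emptyset$, $TODO:=\{[1,(E_i,f_i)]: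 i=1,\dots,d\}$ (the initial multiplied pairs). Step 1: if $TODO=\emptyset$ output $DONE$; otherwise select (and remove from $TODO$) a multiplied pair $[m,p]$ with smallest signature with respect to $\prec_s$. Step 2: if $[m,p]$ meets one of the MJCriterions, go to Step 1; otherwise let $p'$ be obtained from $mp$ by performing top reductions by elements of $DONE$ until the result cannot be top reduced by $DONE$ (TopReductions). Step 3: unless $p'$ is non-initial and equivalent to $mp$ (CheckStore), add to $TODO$ all J-pairs of $p'$ with $p''\in DONE$ (none if the two pairs are similar or one is syzygy), and then add $p'$ to $DONE$; go to Step 1. The MJCriterions are: the GSyzygy Criterion, met by $[m,p]$ if $sig(mp)$ is divisible by a syzygy signature in $DONE$ or by some $\max(sig(v_2p_1),sig(v_1p_2))$ with $p_i=(u_i,v_i)\in DONE$ and $sig(v_2p_1)\neq sig(v_1p_2)$; and the Mpair Criterion, met by $[m,p]$ if $[m,p]$ is neither initial nor an M-pair of $DONE$. *)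

(* Defs.v *)
From mathcomp Require Import all_boot all_order all_algebra.
From mathcomp Require Import mpoly.
From mathcomp Require Import finmap.

Set Implicit Arguments.
Unset Strict Implicit.
Unset Printing Implicit Defensive.

Import GRing.Theory.

Local Open Scope fset_scope.
Local Open Scope ring_scope.

(* The monomial 'X_[m] E_i of the free module is encoded as (m, i). *)
Definition smon (n d : nat) : Type := ('X_{1..n} * 'I_d)%type.

Definition smul n d (m : 'X_{1..n}) (s : smon n d) : smon n d :=
  ((m + s.1)%MM, s.2).

Definition strict (T : eqType) (le : rel T) : rel T :=
  fun x y => (x != y) && le x y.

Definition total_order (T : eqType) (le : rel T) : Prop :=
  [/\ antisymmetric le, transitive le & total le].

Definition admissible_mon n (leM : rel 'X_{1..n}) : Prop :=
  [/\ total_order leM,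
      forall m m1 m2, leM m1 m2 -> leM (m + m1)%MM (m + m2)%MM
    & forall m, m != 0%MM -> strict leM 0%MM m].

Definition admissible_smon n d (leS : rel (smon n d)) : Prop :=
  [/\ total_order leS,
      forall m s1 s2, leS s1 s2 -> leS (smul m s1) (smul m s2)
    & forall m s, m != 0%MM -> strict leS s (smul m s)].

Definition compatible n d (leM : rel 'X_{1..n}) (leS : rel (smon n d)) : Prop :=
  forall s1 s2 m1 m2, leS s1 s2 -> leM m1 m2 ->
    leS (smul m1 s1) (smul m2 s2) /\
    (smul m1 s1 = smul m2 s2 <-> s1 = s2 /\ m1 = m2).

(* A leading monomial is an option, None standing for lm(0) = 0, which is      *)
(* smaller than every monomial and absorbing for products.                     *)
Definition ole (T : eqType) (le : rel T) : rel (option T) := fun x y =>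
  match x, y with
  | None, _ => true
  | Some _, None => false
  | Some a, Some b => le a b
  end.

Definition olt (T : eqType) (le : rel T) : rel (option T) := strict (ole le).

Definition omul n d (m : option 'X_{1..n}) (s : option (smon n d)) :
  option (smon n d) :=
  if m is Some m' then omap (smul m') s else None.

Definition odvd n (x y : option 'X_{1..n}) : bool :=
  if (x, y) is (Some a, Some b) then (a <= b)%MM else false.

Definition odvds n d (x y : option (smon n d)) : bool :=
  if (x, y) is (Some a, Some b) then (a.2 == b.2) && (a.1 <= b.1)%MM else false.

(* u is the row of coordinates of an element of the free module.  Everything   *)
(* below ranges over this type; the actual pairs are those satisfying is_pair. *)
Definition pairT (K : fieldType) (n d : nat) : Type :=
  ('rV[{mpoly K[n]}]_d * {mpoly K[n]})%type.

(* The multiplied pair [m, p]. *)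
Definition mpairT (K : fieldType) (n d : nat) : Type :=
  ('X_{1..n} * pairT K n d)%type.

Record state (K : fieldType) (n d : nat) : Type := State {
  done_of : {fset pairT K n d};
  todo_of : {fset mpairT K n d}
}.

Section TRB.

Context (K : fieldType) (n d : nat).
Context (leM : rel 'X_{1..n}) (leS : rel (smon n d)).
Context (f : 'rV[{mpoly K[n]}]_d).

Implicit Types (p q : pairT K n d) (x y : mpairT K n d).
Implicit Types (D : {fset pairT K n d}) (S : state K n d).

(* The head of the support sorted in decreasing order. *)
Definition lmon (v : {mpoly K[n]}) : option 'X_{1..n} :=
  ohead (sort (fun a b => leM b a) (msupp v)).

Definition slmon (u : 'rV[{mpoly K[n]}]_d) : option (smon n d) :=
  ohead (sort (fun a b => leS b a)
           [seq (m, i) | i <- enum 'I_d, m <- msupp (u 0 i)]).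

Definition lcoef (v : {mpoly K[n]}) : K :=
  if lmon v is Some m then v@_m else 0.

Definition is_pair p : Prop := \sum_(i < d) p.1 0 i * f 0 i = p.2.

Definition lm p : option 'X_{1..n} := lmon p.2.
Definition sig p : option (smon n d) := slmon p.1.

Definition pscale (c : {mpoly K[n]}) p : pairT K n d := (c *: p.1, c * p.2).
Definition psub p q : pairT K n d := (p.1 - q.1, p.2 - q.2).

Definition pltp p q : bool := olt leS (omul (lm p) (sig q)) (omul (lm q) (sig p)).

Definition equivalent p q : bool := (sig p == sig q) && (lm p == lm q).

Definition similar p q : bool := omul (lm p) (sig q) == omul (lm q) (sig p).

Definition syzygy p : bool := lm p == None.

Definition syzygy_signature (s : option (smon n d)) : Prop :=
  exists p, [/\ is_pair p, syzygy p & sig p = s].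

Definition top_reducible p q : bool :=
  [&& ~~ syzygy p, ~~ syzygy q, pltp p q & odvd (lm q) (lm p)].

Definition lt_quot p q : {mpoly K[n]} :=
  if (lm p, lm q) is (Some a, Some b)
  then (lcoef p.2 / lcoef q.2) *: 'X_[(a - b)%MM] else 0.

Definition top_reduce p q : pairT K n d := psub p (pscale (lt_quot p q) q).

Definition TRP p : Prop :=
  [/\ is_pair p, ~~ syzygy p & forall q, is_pair q -> ~~ top_reducible p q].

Definition TRP_similar_set p q : Prop := TRP q /\ similar q p.

Definition TRB p : Prop :=
  TRP p /\
  forall q, TRP_similar_set p q -> ~~ (odvds (sig q) (sig p) && (sig q != sig p)).

Definition TRB_signature (s : option (smon n d)) : Prop :=
  exists p, TRB p /\ sig p = s.

Definition mvalue x : pairT K n d := pscale 'X_[x.1] x.2.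
Definition msig x : option (smon n d) := sig (mvalue x).

(* None when there is no J-pair.  Two non-similar non-syzygy pairs are always  *)
(* comparable for pltp, so the last branch is the case q < p.                  *)
Definition Jpair p q : option (mpairT K n d) :=
  if (lm p, lm q) is (Some a, Some b) then
    if similar p q then None
    else if pltp p q then Some ((mlcm a b - a)%MM, p)
    else Some ((mlcm a b - b)%MM, q)
  else None.

Definition Mpair D x : Prop :=
  [/\ x.2 \in D, x.1 != 0%MM &
      forall y, y.2 \in D -> msig y = msig x -> y.1 != 0%MM ->
        ~~ equivalent y.2 x.2 ->
        pltp x.2 y.2 \/ (similar x.2 y.2 /\ olt leS (sig y.2) (sig x.2))].

Definition initial_pair i : pairT K n d := (delta_mx 0 i, f 0 i).
Definition initial p : Prop := exists i, p = initial_pair i.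
Definition initial_mpair x : Prop := x.1 = 0%MM /\ initial x.2.

Definition smax (s t : option (smon n d)) : option (smon n d) :=
  if ole leS s t then t else s.

Definition GSyzygy_criterion D x : Prop :=
  (exists p, [/\ p \in D, syzygy p & odvds (sig p) (msig x)]) \/
  (exists p q, let s := sig (pscale q.2 p) in let t := sig (pscale p.2 q) in
     [/\ p \in D, q \in D, s != t & odvds (smax s t) (msig x)]).

Definition Mpair_criterion D x : Prop := ~ initial_mpair x /\ ~ Mpair D x.

Definition MJ_criterions D x : Prop :=
  GSyzygy_criterion D x \/ Mpair_criterion D x.

Inductive top_reds D : pairT K n d -> pairT K n d -> Prop :=
| TopRedsNone p of (forall q, q \in D -> ~~ top_reducible p q) : top_reds D p p
| TopRedsStep p q p' of q \in D & top_reducible p q &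
    top_reds D (top_reduce p q) p' : top_reds D p p'.

Definition init_state : state K n d :=
  State fset0 [fset (0%MM : 'X_{1..n}, initial_pair i) | i : 'I_d].

Definition selectable S x : Prop :=
  x \in todo_of S /\ forall y, y \in todo_of S -> ole leS (msig x) (msig y).

Definition check_store p' x : Prop := ~ initial p' /\ equivalent p' (mvalue x).

Definition new_Jpairs D p' : {fset mpairT K n d} :=
  [fset x in pmap (Jpair p') (enum_fset D)].

(* One iteration of the main loop; both the selection among the smallest       *)
(* signatures and the order of the top reductions are nondeterministic.        *)
Inductive step S : state K n d -> Prop :=
| StepCriterion x of selectable S x & MJ_criterions (done_of S) x :
    step S (State (done_of S) (todo_of S `\ x))
| StepSkip x p' of selectable S x & ~ MJ_criterions (done_of S) x &
    top_reds (done_of S) (mvalue x) p' & check_store p' x :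
    step S (State (done_of S) (todo_of S `\ x))
| StepStore x p' of selectable S x & ~ MJ_criterions (done_of S) x &
    top_reds (done_of S) (mvalue x) p' & ~ check_store p' x :
    step S (State (p' |` done_of S)
                  ((todo_of S `\ x) `|` new_Jpairs (done_of S) p')).

(* The states met during a run; a terminated run ends in a reachable state     *)
(* with empty todo_of, whose done_of is the output.                            *)
Inductive reachable : state K n d -> Prop :=
| ReachInit : reachable init_state
| ReachStep S S' of reachable S & step S S' : reachable S'.

End TRB.

(* Main.v *)
Require Import Defs.
From mathcomp Require Import all_boot all_order all_algebra.
From mathcomp Require Import finmap mpoly.
From Stdlib Require Import Classical IndefiniteDescription.

(* Call a pair least when no pair of the same signature has a smaller leading
   monomial; the least non-syzygy pairs are exactly the TRP pairs.  Admissible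
   orders are well-founded by Dickson's lemma, and by induction on signatures
   every signature [t] below all those of TODO is covered: [t] is syzygy, or some
   multiple [cq] of a [q] in DONE is a least pair signed [t].  Therefore a pair
   irreducible by DONE is least when its signature is minimal in TODO.  Suppose
   now that [p'] is stored after [mp], an M-pair signed [s], was really reduced.
   If a TRP pair similar to [p'] had signature [t] with [s = et] and [e <> 1],
   covering [t] by [cq] would give the competitor [(ec, q)] of [(m, p)], whose
   leading monomial is at most [lm(p')], hence less than that of [mp],
   contradicting the choice of the M-pair. *)

Set Implicit Arguments.
Unset Strict Implicit.
Unset Printing Implicit Defensive.

Import GRing.Theory.

Local Open Scope fset_scope.
Local Open Scope ring_scope.

(** * Dickson's lemma *)

Lemma nondecreasing_subseq (g : nat -> nat) :
  exists phi : nat -> nat,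
    {homo phi : i j / (i < j)%N} /\ {homo g \o phi : i j / (i <= j)%N}.
Proof.
have ex_min k :
    exists j, (k <= j)%N /\ forall j', (k <= j')%N -> (g j <= g j')%N.
  (* Without such a [j], induction on [v] shows that [g] is at least [v] everywhere from [k] on,
     which is absurd for [v = g k + 1]. *)
  apply: NNPP => no_min.
  suff H v : forall j, (k <= j)%N -> (v <= g j)%N.
    by have := H (g k).+1 k (leqnn k); rewrite ltnn.
  elim: v => [//|v IHv] j le_kj; rewrite ltn_neqAle IHv // andbT.
  apply/eqP => eq_v; apply: no_min; exists j; split=> // j' le_kj'.
  by rewrite -eq_v IHv.
pose h k := sval (constructive_indefinite_description _ (ex_min k)).
have le_h k : (k <= h k)%N.
  by rewrite /h; case: constructive_indefinite_description => j [].
have min_h k j : (k <= j)%N -> (g (h k) <= g j)%N.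
  by rewrite /h; case: constructive_indefinite_description => ? [? /=]; apply.
(* [h k] is a position from [k] on where [g] is minimal over all positions from [k] on; restarting
   just after each choice makes the positions strictly increase. *)
pose phi i := iter i (fun x => h x.+1) (h 0).
exists phi; split; first by apply: (homo_ltn ltn_trans) => i; apply: le_h.
apply: (homo_leq leqnn leq_trans) => i.
case: i => [|i] /=; first exact: min_h.
by apply: min_h; apply: leq_trans (le_h _); apply: leqW; apply: le_h.
Qed.

(** Coordinates are treated one at a time: refining a subsequence keeps the monotonicity already
    obtained, and the first two terms of the last subsequence are the required pair. *)
Lemma dickson (I : finType) (T : Type) (G : I -> T -> nat) (x : nat -> T) :
  exists i j, (i < j)%N /\ forall k, (G k (x i) <= G k (x j))%N.
Proof.
suff [phi [phi_mono G_mono]] : exists phi : nat -> nat,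
    {homo phi : i j / (i < j)%N} /\
    forall k, k \in enum I -> {homo G k \o x \o phi : i j / (i <= j)%N}.
  exists (phi 0), (phi 1); split=> [|k]; first exact: phi_mono.
  by apply: (G_mono k) => //; rewrite mem_enum.
elim: (enum I) => [|k s [phi [phi_mono IHs]]]; first by exists id;
  split=> // k; rewrite in_nil.
have [psi [psi_mono G_mono]] := nondecreasing_subseq (G k \o x \o phi).
exists (phi \o psi); split=> [i j /psi_mono /phi_mono //|k'].
rewrite inE => /predU1P[-> // | /IHs k'_mono] i j le_ij; apply: k'_mono.
by move: le_ij; rewrite leq_eqVlt => /predU1P[-> // | /psi_mono /ltnW].
Qed.

(** * Total orders and existence of minima *)

Section Orders.

Context (T : eqType) (le : rel T).
Hypothesis le_total : total_order le.

Lemma to_refl x : le x x.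
Proof. by case: le_total => _ _ tot; have := tot x x; rewrite orbb. Qed.

Lemma to_trans y x z : le x y -> le y z -> le x z.
Proof. by case: le_total => _ tr _; apply: tr. Qed.

Lemma to_anti x y : le x y -> le y x -> x = y.
Proof. by case: le_total => anti _ _ xy yx; apply: anti; rewrite xy yx. Qed.

Lemma to_ltNge x y : strict le x y = ~~ le y x.
Proof.
case: le_total => anti _ tot; rewrite /strict; apply/andP/idP => [[ne xy]|nyx].
  by apply: contra ne => yx; apply/eqP/anti; rewrite xy yx.
split; last by have := tot x y; rewrite (negPf nyx) orbF.
by apply: contra nyx => /eqP->; apply: to_refl.
Qed.

Lemma to_leNgt x y : le x y = ~~ strict le y x.
Proof. by rewrite to_ltNge negbK. Qed.

Lemma to_ltW x y : strict le x y -> le x y.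
Proof. by case/andP. Qed.

Lemma to_le_lt_trans y x z : le x y -> strict le y z -> strict le x z.
Proof. rewrite !to_ltNge => xy; apply: contra => zx; exact: to_trans zx xy. Qed.

Lemma to_lt_le_trans y x z : strict le x y -> le y z -> strict le x z.
Proof. rewrite !to_ltNge => xy yz; apply: contra xy; exact: to_trans. Qed.

Lemma ole_total : total_order (ole le).
Proof.
split.
- case=> [x|] [y|] //= /andP[xy yx]; congr Some; exact: to_anti.
- case=> [y|] [x|] [z|] //=; exact: to_trans.
- case=> [x|] [y|] //=; by case: le_total => _ _; apply.
Qed.

(** A set without minimum would contain, by choice, a strictly descending sequence, in which
    Dickson's lemma finds two terms that [le] orders the other way. *)
Lemma ordered_min (I : finType) (G : I -> T -> nat) :
  (forall x y, (forall k, (G k x <= G k y)%N) -> le x y) ->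
  forall P : T -> Prop, (exists x, P x) ->
  exists x, P x /\ forall y, P y -> le x y.
Proof.
move=> leG P [x0 Px0]; apply: NNPP => no_min.
have next (x : {x | P x}) : exists y : {x | P x}, ~~ le (sval x) (sval y).
  apply: NNPP => no_next; case: x no_next => x Px no_next; apply: no_min.
  exists x; split=> // y Py; apply/negPn/negP => nle.
  by apply: no_next; exists (exist _ y Py).
pose h x := sval (constructive_indefinite_description _ (next x)).
have hP x : strict le (sval (h x)) (sval x).
  by rewrite to_ltNge /h; case: constructive_indefinite_description.
pose u i := sval (iter i h (exist _ x0 Px0)).
have desc : {homo u : i j / (i < j)%N >-> strict le j i}.
  apply: homo_ltn => [y x z xy yz|i]; last exact: hP.
  by apply: to_lt_le_trans yz _; apply: to_ltW.
have [i [j [lt_ij Gij]]] := dickson G u.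
by have := desc _ _ lt_ij; rewrite to_ltNge leG.
Qed.

End Orders.

(** * Leading elements of coefficient functions *)

Definition lead (T : eqType) (le : rel T) (K : fieldType) (c : T -> K)
  (o : option T) : Prop :=
  if o is Some m then c m != 0 /\ forall m', c m' != 0 -> le m' m
  else forall m, c m = 0.

Section Lead.

Context (T : eqType) (le : rel T) (K : fieldType).
Hypothesis le_total : total_order le.
Implicit Types (c : T -> K) (o : option T).

(** The sequence [s] is any enumeration of the support, so that polynomials and vectors of the free
    module are treated alike. *)
Lemma lead_sort c (s : seq T) : (forall m, (m \in s) = (c m != 0)) ->
  lead le c (ohead (sort (fun a b => le b a) s)).
Proof.
move=> supp_c.
have tot : total (fun a b => le b a).
  by move=> a b; case: le_total => _ _; apply.
have tr : transitive (fun a b => le b a).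
  by move=> a b x ab xa; apply: (to_trans le_total) xa ab.
have := sort_sorted tot s; have := mem_sort (fun a b => le b a) s.
case: sort => [|m r] mem_s /=; last first.
  move/(order_path_min tr)/allP => max_m; split=> [|m'].
    by rewrite -supp_c -mem_s mem_head.
  rewrite -supp_c -mem_s inE => /predU1P[->|/max_m //]; exact: to_refl.
by move=> _ m; apply/eqP/negPn; rewrite -supp_c -mem_s.
Qed.

Lemma lead_ext c c' o : c =1 c' -> lead le c o -> lead le c' o.
Proof.
by move=> eq_c; case: o => [m [cm max_m]|c0] => [|m]; [split=> [|m'] |];
  rewrite -eq_c ?c0 //; apply: max_m.
Qed.

Lemma lead_uniq c o o' : lead le c o -> lead le c o' -> o = o'.
Proof.
case: o o' => [m|] [m'|] //= H H'.
- congr Some; apply: (to_anti le_total); first by apply: H'.2; exact: H.1.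
  by apply: H.2; exact: H'.1.
- by have := H.1; rewrite H' eqxx.
- by have := H'.1; rewrite H eqxx.
Qed.

(** At and above [m] the function [c'] vanishes, so [c] is not changed there. *)
Lemma lead_subl c c' a o o' : lead le c o -> lead le c' o' ->
  olt le o' o -> lead le (fun m => c m - a * c' m) o.
Proof.
case: o => [m|]; last by case: o' => [m'|] //=; rewrite /olt /strict /= eqxx.
case=> c_m max_m lead_c' lt_o'.
have c'0 m' : le m m' -> c' m' = 0.
  case: o' lead_c' lt_o' => [m0|] //= [_ max_m0] lt_m0 le_m.
  have {}lt_m0 : strict le m0 m by [].
  apply/eqP/negPn/negP => /max_m0 le_m'.
  by move: lt_m0; rewrite to_ltNge // (to_trans le_total le_m).
split=> [|m']; first by rewrite c'0 ?to_refl // mulr0 subr0.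
have [/eqP cm0 | /max_m //] := boolP (c m' == 0).
move=> nz; rewrite to_leNgt //; apply: contra nz => /(to_ltW) le_m.
by rewrite cm0 c'0 // mulr0 subr0.
Qed.

(** The coefficients at [m] cancel, and both supports lie at or below [m]. *)
Lemma lead_sub_cancel c c' m o : lead le c (Some m) -> lead le c' (Some m) ->
  lead le (fun k => c k - c m / c' m * c' k) o -> olt le o (Some m).
Proof.
case=> cm max_c [c'm max_c']; case: o => [k|] //= [nz _].
have -> : olt le (Some k) (Some m) = strict le k m by [].
apply/andP; split.
  by apply: contra nz => /eqP ->; rewrite divfK // subrr.
have [ck|] := eqVneq (c k) 0; last exact: max_c.
by apply: max_c'; apply: contra nz => /eqP ->; rewrite ck mulr0 subr0.
Qed.

(** Intended for multiplication by a monomial: [sh] shifts exponents, and the support of the product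
    lies in its image. *)
Lemma lead_shift (sh : T -> T) c c' o :
  (forall x y, le x y -> le (sh x) (sh y)) ->
  (forall x, c' (sh x) = c x) ->
  (forall y, c' y != 0 -> exists x, y = sh x) ->
  lead le c o -> lead le c' (omap sh o).
Proof.
move=> sh_mono c'E supp_c'; case: o => [m|] /= => [[cm max_m]|c0].
  split=> [|y c'y]; first by rewrite c'E.
  have [x yE] := supp_c' y c'y; rewrite yE in c'y *.
  by apply/sh_mono/max_m; rewrite -c'E.
move=> y; apply/eqP/negPn/negP => c'y; have [x yE] := supp_c' y c'y.
by move: c'y; rewrite yE c'E c0 eqxx.
Qed.

End Lead.

Lemma mcoeffXM_supp (K : fieldType) n (m k : 'X_{1..n}) (v : {mpoly K[n]}) :
  ('X_[m] * v)@_k != 0 -> exists k', k = (m + k')%MM.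
Proof.
rewrite mulrC -mcoeff_msupp (perm_mem (msuppMX _ _)) => /mapP[k' _ ->].
by exists k'.
Qed.

(** * Compatible admissible orders: cancellation and well-foundedness *)

Section SignatureTheory.

Context (K : fieldType) (n d : nat).
Context (leM : rel 'X_{1..n}) (leS : rel (smon n d)).
Context (f : 'rV[{mpoly K[n]}]_d).
Hypotheses (hM : admissible_mon leM) (hS : admissible_smon leS).
Hypothesis hMS : compatible leM leS.

Implicit Types (p q r : pairT K n d) (x y : mpairT K n d).
Implicit Types (m c : 'X_{1..n}) (s t : smon n d).
Implicit Types (D : {fset pairT K n d}) (S : state K n d).

Local Notation lm := (lm leM).
Local Notation sig := (sig leS).
Local Notation lmon := (lmon leM).
Local Notation slmon := (slmon leS).
Local Notation pltp := (pltp leM leS).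
Local Notation similar := (Defs.similar leM leS).
Local Notation is_pair := (is_pair f).

Let totM : total_order leM. Proof. by case: hM. Qed.
Let totS : total_order leS. Proof. by case: hS. Qed.

Lemma leM_add m m1 m2 : leM m1 m2 -> leM (m + m1)%MM (m + m2)%MM.
Proof. by case: hM => _ H _; apply: H. Qed.

Lemma leM_add2l m m1 m2 : leM (m + m1)%MM (m + m2)%MM = leM m1 m2.
Proof.
apply/idP/idP => [le_m|]; last exact: leM_add.
rewrite to_leNgt //; apply/negP => lt21.
have eq12 := addmI (to_anti totM le_m (leM_add m (to_ltW lt21))).
by move: lt21; rewrite eq12 /strict eqxx.
Qed.

Lemma ltM_add2l m m1 m2 : strict leM (m + m1)%MM (m + m2)%MM = strict leM m1 m2.
Proof. by rewrite !to_ltNge // leM_add2l. Qed.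

Lemma dvd_leM m1 m2 : (m1 <= m2)%MM -> leM m1 m2.
Proof.
move=> dvd12; rewrite -(submK dvd12) addmC -{1}(addm0 m1) leM_add2l.
have [->|nz] := eqVneq (m2 - m1)%MM 0%MM; first exact: to_refl.
by case: hM => _ _ /(_ _ nz)/to_ltW.
Qed.

Lemma smulA m1 m2 s : smul m1 (smul m2 s) = smul (m1 + m2)%MM s.
Proof. by rewrite /smul /= addmA. Qed.

Lemma smulCA m1 m2 s : smul m1 (smul m2 s) = smul m2 (smul m1 s).
Proof. by rewrite !smulA addmC. Qed.

Lemma smul0 s : smul 0%MM s = s.
Proof. by case: s => a b; rewrite /smul add0m. Qed.

Lemma smulI m : injective (@smul n d m).
Proof.
move=> [a i] [b j] eq_ab; move: (congr1 fst eq_ab) (congr1 snd eq_ab).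
by move=> /= /addmI -> ->.
Qed.

Lemma smulIr s m1 m2 : smul m1 s = smul m2 s -> m1 = m2.
Proof. by move/(congr1 fst)/addIm. Qed.

Lemma leS_mul2l m s t : leS (smul m s) (smul m t) = leS s t.
Proof.
have mono a b : leS a b -> leS (smul m a) (smul m b).
  by case: hS => _ H _; apply: H.
apply/idP/idP => [le_s|]; last exact: mono.
rewrite to_leNgt //; apply/negP => lt_ts.
have /smulI eq_st := to_anti totS le_s (mono _ _ (to_ltW lt_ts)).
by move: lt_ts; rewrite eq_st /strict eqxx.
Qed.

(** Monotonicity is compatibility with both module monomials equal to [s]; the converse follows by
    totality, a module monomial being cancellable. *)
Lemma leS_mul2r s m1 m2 : leS (smul m1 s) (smul m2 s) = leM m1 m2.
Proof.
have mono a b : leM a b -> leS (smul a s) (smul b s).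
  by move=> le_ab; case: (hMS (to_refl totS s) le_ab).
apply/idP/idP => [le_s|]; last exact: mono.
rewrite to_leNgt //; apply/negP => lt21.
have /smulIr eq12 := to_anti totS le_s (mono _ _ (to_ltW lt21)).
by move: lt21; rewrite eq12 /strict eqxx.
Qed.

Lemma ltS_mul2l m s t : strict leS (smul m s) (smul m t) = strict leS s t.
Proof. by rewrite !to_ltNge // leS_mul2l. Qed.

Lemma ltS_mul2r s m1 m2 :
  strict leS (smul m1 s) (smul m2 s) = strict leM m1 m2.
Proof. by rewrite !to_ltNge // leS_mul2r. Qed.

Lemma ltS_mul m s : m != 0%MM -> strict leS s (smul m s).
Proof. by case: hS => _ _; apply. Qed.

Lemma leM_min (P : 'X_{1..n} -> Prop) : (exists m, P m) ->
  exists m, P m /\ forall m', P m' -> leM m m'.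
Proof.
apply: (@ordered_min _ leM totM _ (fun (k : 'I_n) m => m k)) => m1 m2 le12.
by apply/dvd_leM/mnm_lepP.
Qed.

(* The coordinates [i] and [d - i] are compared both ways, which forces equal
   components. *)
Lemma leS_min (P : smon n d -> Prop) : (exists s, P s) ->
  exists s, P s /\ forall t, P t -> leS s t.
Proof.
pose G (k : 'I_n + bool) (s : smon n d) : nat :=
  match k with inl k => s.1 k | inr b => if b then val s.2 else (d - s.2)%N end.
apply: (@ordered_min _ leS totS _ G) => -[a i] [b j] le_st.
have eq_ij : i = j.
  apply/val_inj/eqP; rewrite eqn_leq (le_st (inr true)) /=.
  by rewrite -(leq_sub2lE _ (ltnW (ltn_ord j))) (le_st (inr false)).
have -> : (a, i) = smul a (0%MM, i) by rewrite /smul addm0.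
have -> : (b, j) = smul b (0%MM, i) by rewrite /smul addm0 eq_ij.
by rewrite leS_mul2r; apply/dvd_leM/mnm_lepP => k; apply: (le_st (inl k)).
Qed.

Lemma ltS_ind (P : smon n d -> Prop) :
  (forall s, (forall t, strict leS t s -> P t) -> P s) -> forall s, P s.
Proof.
move=> IH s; apply: NNPP => nPs.
have [s0 [nPs0 min_s0]] := leS_min (ex_intro (fun s => ~ P s) s nPs).
apply: nPs0; apply: IH => t lt_t; apply: NNPP => /min_s0.
by apply/negP; rewrite -to_ltNge.
Qed.

(** * Leading monomials and signatures of combinations and multiples *)

Lemma lmonP (v : {mpoly K[n]}) : lead leM (fun m => v@_m) (lmon v).
Proof. by apply: lead_sort => // m; rewrite mcoeff_msupp. Qed.

Lemma slmonP (u : 'rV[{mpoly K[n]}]_d) :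
  lead leS (fun s => (u 0 s.2)@_s.1) (slmon u).
Proof.
apply: lead_sort => // -[m i]; rewrite /= -mcoeff_msupp.
apply/allpairsPdep/idP => [[i0 [m0 [_ supp_m [-> ->]]]] //|supp_m].
by exists i, m; rewrite mem_enum.
Qed.

(** The coefficient [a] is a scalar: monomial multiples are formed by [mvalue] first, so that a top
    reduction is a [combine] with such a multiple. *)
Definition combine p (a : K) q : pairT K n d := psub p (pscale a%:MP q).

Lemma combine_coefl p a q i m :
  ((combine p a q).1 0 i)@_m = (p.1 0 i)@_m - a * (q.1 0 i)@_m.
Proof. by rewrite /= !mxE mcoeffB mcoeffCM. Qed.

Lemma combine_coefr p a q m :
  (combine p a q).2@_m = p.2@_m - a * q.2@_m.
Proof. by rewrite /= mcoeffB mcoeffCM. Qed.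

Lemma pair_scale g p : is_pair p -> is_pair (pscale g p).
Proof.
rewrite /Defs.is_pair /= => <-; rewrite mulr_sumr; apply: eq_bigr => i _.
by rewrite mxE mulrA.
Qed.

Lemma pair_sub p q : is_pair p -> is_pair q -> is_pair (psub p q).
Proof.
rewrite /Defs.is_pair /= => <- <-; rewrite -sumrB; apply: eq_bigr => i _.
by rewrite !mxE mulrBl.
Qed.

Lemma pair_combine p a q : is_pair p -> is_pair q -> is_pair (combine p a q).
Proof. by move=> pp pq; apply/pair_sub/pair_scale. Qed.

Lemma pair_mvalue x : is_pair x.2 -> is_pair (mvalue x).
Proof. exact: pair_scale. Qed.

Lemma ole_olt_trans (a b c : option 'X_{1..n}) :
  ole leM a b -> olt leM b c -> olt leM a c.
Proof. exact: to_le_lt_trans (ole_total totM) _ _ _. Qed.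

Lemma lm_combine p a q : olt leM (lm q) (lm p) -> lm (combine p a q) = lm p.
Proof.
move=> lt_qp; apply: (lead_uniq totM (lmonP _)).
have := lead_subl totM a (lmonP p.2) (lmonP q.2) lt_qp.
by apply: lead_ext => m; rewrite combine_coefr.
Qed.

Lemma sig_combine p a q : olt leS (sig q) (sig p) ->
  sig (combine p a q) = sig p.
Proof.
move=> lt_qp; apply: (lead_uniq totS (slmonP _)).
have := lead_subl totS a (slmonP p.1) (slmonP q.1) lt_qp.
by apply: lead_ext => m; rewrite combine_coefl.
Qed.

Lemma lm_combine_cancel p q m : lm p = Some m -> lm q = Some m ->
  olt leM (lm (combine p (p.2@_m / q.2@_m) q)) (Some m).
Proof.
move=> lm_p lm_q; have := lmonP p.2; have := lmonP q.2.
rewrite -/(lm p) -/(lm q) lm_p lm_q => lead_q lead_p.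
apply: lead_sub_cancel lead_p lead_q _.
by have := lmonP (combine p (p.2@_m / q.2@_m) q).2; apply: lead_ext => k;
  rewrite combine_coefr.
Qed.

Lemma sig_combine_cancel p q s : sig p = Some s -> sig q = Some s ->
  exists a, olt leS (sig (combine p a q)) (Some s).
Proof.
move=> sig_p sig_q; have := slmonP p.1; have := slmonP q.1.
(* The scalar left open here is fixed by [lead_sub_cancel]: the quotient of the two leading
   coefficients. *)
rewrite -/(sig p) -/(sig q) sig_p sig_q => lead_q lead_p; eexists.
apply: lead_sub_cancel lead_p lead_q _.
have := slmonP (combine p ((p.1 0 s.2)@_s.1 / (q.1 0 s.2)@_s.1) q).1.
by apply: lead_ext => k; rewrite combine_coefl.
Qed.

Lemma lm_mvalue m p : lm (mvalue (m, p)) = omap (fun k => (m + k)%MM) (lm p).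
Proof.
apply: (lead_uniq totM (lmonP _)).
apply: (lead_shift _ _ _ (lmonP p.2)) => [a b | a | a].
- by rewrite leM_add2l.
- by rewrite /= mulrC mcoeffMX.
- exact: mcoeffXM_supp.
Qed.

Lemma sig_mvalue m p : sig (mvalue (m, p)) = omap (smul m) (sig p).
Proof.
apply: (lead_uniq totS (slmonP _)).
apply: (lead_shift _ _ _ (slmonP p.1)) => [a b | a | [a i]].
- by rewrite leS_mul2l.
- by rewrite /= mxE mulrC mcoeffMX.
- rewrite /= mxE => /mcoeffXM_supp[k ->]; by exists (k, i).
Qed.

Lemma mvalue0 p : mvalue (0%MM, p) = p.
Proof. by case: p => u v; rewrite /mvalue /pscale /= mpolyX0 scale1r mul1r. Qed.

Lemma mvalueD m1 m2 p : mvalue (m1, mvalue (m2, p)) = mvalue ((m1 + m2)%MM, p).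
Proof. by rewrite /mvalue /pscale /= scalerA mulrA mpolyXD. Qed.

Lemma sig_initial i : sig (initial_pair f i) = Some (0%MM, i).
Proof.
apply: (lead_uniq totS (slmonP _)) => /=; split=> [|[m j]] /=.
  by rewrite mxE !eqxx mcoeff1 eqxx oner_eq0.
rewrite mxE eqxx /=; case: (j =P i) => [-> |_]; last by rewrite mcoeff0 eqxx.
rewrite mcoeff1; case: (m =P 0%MM) => [-> _|_]; last by rewrite eqxx.
exact: to_refl.
Qed.

Lemma pair_initial i : is_pair (initial_pair f i).
Proof.
rewrite /Defs.is_pair /= (bigD1 i) //= big1 => [|j ne_ji].
  by rewrite mxE !eqxx mul1r addr0.
by rewrite mxE (negPf ne_ji) andbF mul0r.
Qed.

(** If [u = 0], then [v], being the product of [u] and [f], is 0 as well. *)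
Lemma sig_neq_None p : is_pair p -> lm p != None -> sig p != None.
Proof.
move=> pp; apply: contra => /eqP sig_p; apply/eqP.
have := slmonP p.1; rewrite -/(sig p) sig_p => /= p10.
apply: (lead_uniq totM (lmonP _)) => m.
rewrite -pp big1 ?mcoeff0 // => i _.
have -> : p.1 0 i = 0 by apply/mpolyP => k; rewrite (p10 (k, i)) mcoeff0.
by rewrite mul0r.
Qed.

(** * Least pairs and top reduction *)

Definition least p : Prop :=
  is_pair p /\
  forall q, is_pair q -> sig q = sig p -> ole leM (lm p) (lm q).

Local Notation syz := (syzygy_signature leM leS f).

(* If [q] beats [p] at the signature [s], cancelling the signatures of [p] and
   [q] moves [lm p] to a smaller signature. *)
Lemma lower_signature p q s : is_pair p -> is_pair q ->
  sig p = Some s -> sig q = Some s -> olt leM (lm q) (lm p) ->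
  exists r t, [/\ is_pair r, lm r = lm p, sig r = Some t & strict leS t s].
Proof.
move=> pp pq sig_p sig_q lt_qp.
have [a lt_r] := sig_combine_cancel sig_p sig_q.
have pr := pair_combine a pp pq; have lm_r := lm_combine a lt_qp.
have : sig (combine p a q) != None.
  apply: sig_neq_None => //; rewrite lm_r.
  by apply: contraTneq lt_qp => ->; case: (lm q) => [?|];
    rewrite /olt /strict /= ?eqxx.
case sig_r: (sig (combine p a q)) lt_r => [t|] // lt_t _.
by exists (combine p a q), t.
Qed.

(** With [a = c b], cancelling [b] from the cross products in [pltp] leaves the signature of the
    multiple [cq] below that of [p]. *)
Lemma top_reducibleP p q a s : lm p = Some a -> sig p = Some s ->
  is_pair q ->
  reflect (exists b t c, [/\ lm q = Some b, sig q = Some t, a = (c + b)%MM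
                           & strict leS (smul c t) s])
          (top_reducible leM leS p q).
Proof.
move=> lm_p sig_p pq; rewrite /top_reducible /syzygy /Defs.pltp lm_p sig_p.
have := sig_neq_None pq.
case: (lm q) => [b|] /=; last by move=> _;
  apply: (iffP idP) => // -[b [t [c []]]].
case: (sig q) => [t|] /=; last by move/(_ isT).
move=> _; rewrite {1}/odvd.
have ltE c : a = (c + b)%MM ->
    olt leS (Some (smul a t)) (Some (smul b s)) = strict leS (smul c t) s.
  by move=> ->; rewrite -[RHS](ltS_mul2l b) smulA addmC.
apply: (iffP andP) => [[lt_qp dvd_ba]|[b' [t' [c [[<-] [<-] aE lt_s]]]]].
  have aE : a = (a - b + b)%MM by rewrite submK.
  by exists b, t, (a - b)%MM; rewrite -(ltE _ aE).
by rewrite (ltE _ aE) aE lem_addl.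
Qed.

(** The reduction subtracts a scalar multiple of [r = cq], which has the leading monomial of [p] but
    a smaller signature: leading monomials cancel and the signature survives. *)
Lemma top_reduceP p q : is_pair p -> is_pair q ->
  top_reducible leM leS p q ->
  [/\ is_pair (top_reduce leM p q), sig (top_reduce leM p q) = sig p
    & olt leM (lm (top_reduce leM p q)) (lm p)].
Proof.
move=> pp pq red.
have : ~~ syzygy leM p by case/and4P: red.
rewrite /syzygy => /[dup] /(sig_neq_None pp).
case lm_p: (lm p) => [a|] //; case sig_p: (sig p) => [s|] // _ _.
have /(top_reducibleP lm_p sig_p pq)[b [t [c [lm_q sig_q aE lt_s]]]] := red.
pose r := mvalue (c, q).
have lm_r : lm r = Some a by rewrite lm_mvalue lm_q aE.
have sig_r : sig r = Some (smul c t) by rewrite sig_mvalue sig_q.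
have -> : top_reduce leM p q = combine p (p.2@_a / r.2@_a) r.
  rewrite /top_reduce /lt_quot lm_p lm_q /lcoef -/(lm p) -/(lm q) lm_p lm_q.
  have -> : r.2@_a = q.2@_b by rewrite /r /= aE mulrC mcoeffMX.
  by rewrite /combine /r /mvalue /pscale /= aE addmK scalerA mulrA mul_mpolyC.
split; first by apply: pair_combine => //; apply: pair_mvalue.
  by rewrite sig_combine sig_p // sig_r.
by rewrite -lm_p; rewrite lm_p; apply: lm_combine_cancel.
Qed.

Lemma least_irreducible p q : least p -> is_pair q ->
  ~~ top_reducible leM leS p q.
Proof.
case=> pp min_p pq; apply/negP => /(top_reduceP pp pq)[pr sig_r].
by rewrite /olt to_ltNge ?min_p //; apply: ole_total.
Qed.

Lemma least_TRP p : least p -> ~~ syzygy leM p -> TRP leM leS f p.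
Proof. by move=> lp nsyz; split=> //; [case: lp | move=> q;
  apply: least_irreducible]. Qed.

Definition covered D (o : option (smon n d)) : Prop :=
  syz o \/
  exists c q, [/\ q \in D, sig (mvalue (c, q)) = o & least (mvalue (c, q))].

Lemma covered_sub D D' o : {subset D <= D'} -> covered D o -> covered D' o.
Proof.
move=> sub [|[c [q [qD sig_q lq]]]]; first by left.
by right; exists c, q; split=> //; apply: sub.
Qed.

(* Among the pairs with leading monomial [lm p], the one of smallest signature
   is least, so it is a multiple of an element of [D], which reduces [p]. *)
Lemma irreducible_least D p s : (forall q, q \in D -> is_pair q) ->
  is_pair p -> sig p = Some s ->
  (forall t, strict leS t s -> covered D (Some t)) ->
  (forall q, q \in D -> ~~ top_reducible leM leS p q) -> least p.
Proof.
move=> pD pp sig_p cov irr; split=> // q pq; rewrite sig_p => sig_q.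
rewrite to_leNgt; last exact: ole_total.
apply/negP => lt_qp.
have [r0 [t0 [pr0 lm_r0 sig_r0 lt_t0]]] :=
  lower_signature pp pq sig_p sig_q lt_qp.
pose P t := exists r, [/\ is_pair r, lm r = lm p & sig r = Some t].
have [t [[r [pr lm_r sig_r]] min_t]] : exists t, P t /\ forall t', P t' ->
  leS t t'.
  by apply: leS_min; exists t0, r0.
have lt_ts : strict leS t s.
  by apply: to_le_lt_trans lt_t0 => //; apply: min_t; exists r0.
(* A better pair signed [t] would, by [lower_signature], yield a pair with leading monomial [lm p]
   signed below [t]. *)
have lr : least r.
  split=> // q' pq'; rewrite sig_r => sig_q'.
  rewrite to_leNgt; last exact: ole_total.
  apply/negP => /(lower_signature pr pq' sig_r sig_q')[r' [t' [pr' lm_r' sig_r'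
    lt_t']]].
  by move: lt_t'; rewrite to_ltNge // min_t //; exists r'; rewrite lm_r'.
case lm_p: (lm p) lt_qp lm_r => [a|] lt_qp lm_r; last by case: (lm q) lt_qp.
case: (cov t lt_ts) => [[z [pz /eqP lm_z sig_z]]|[c [g [gD sig_g lg]]]].
  by case: lr => _ /(_ z pz); rewrite sig_r sig_z lm_r lm_z => /(_ erefl).
(* Two least pairs of the same signature have the same leading monomial. *)
have lm_g : lm (mvalue (c, g)) = Some a.
  rewrite -lm_r; apply: (to_anti (ole_total totM)).
    by apply: lg.2 => //; rewrite sig_r.
  by apply: lr.2; [case: lg | rewrite sig_g].
move: (irr g gD) => /negP; apply; apply/(top_reducibleP lm_p sig_p (pD _ gD)).
move: lm_g sig_g; rewrite lm_mvalue sig_mvalue.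
case: (lm g) => [b|] //= [<-]; case: (sig g) => [t1|] //= [tE].
by exists b, t1, c; rewrite tE.
Qed.

(** * Syzygy signatures, the criteria and the loop invariant *)

Lemma syz_smul m s : syz (Some s) -> syz (Some (smul m s)).
Proof.
case=> p [pp /eqP lm_p sig_p]; exists (mvalue (m, p)); split.
- exact: pair_mvalue.
- by rewrite /syzygy lm_mvalue lm_p.
- by rewrite sig_mvalue sig_p.
Qed.

Lemma odvds_syz o o' : syz o -> odvds o o' -> syz o'.
Proof.
case: o o' => [s|] [t|] //= syz_s /andP[/eqP eq_i dvd].
have -> : t = smul (t.1 - s.1)%MM s.
  by rewrite /smul submK // eq_i -surjective_pairing.
exact: syz_smul.
Qed.

(** In the second case the difference of [P] and [Q] has second component 0, and because their
    signatures differ the larger one is not cancelled. *)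
Lemma GSyzygy_syz D x : (forall q, q \in D -> is_pair q) ->
  GSyzygy_criterion leM leS D x -> syz (msig leS x).
Proof.
move=> pD [[p [pD' syz_p]] | [p [q [pD' qD]]]].
  by apply: odvds_syz; exists p; split=> //; apply: pD.
set P := pscale q.2 p; set Q := pscale p.2 q => ne_sig.
have pP : is_pair P by apply/pair_scale/pD.
have pQ : is_pair Q by apply/pair_scale/pD.
have eq_PQ : P.2 = Q.2 by rewrite /= mulrC.
apply: odvds_syz.
have syz_combine A B : is_pair A -> is_pair B -> A.2 = B.2 ->
    olt leS (sig B) (sig A) -> syz (sig A).
  move=> pA pB eq_AB lt_BA; exists (combine A 1 B).
  split; [exact: pair_combine | | exact: sig_combine].
  apply/eqP; apply: (lead_uniq totM (lmonP _)) => m.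
  by rewrite combine_coefr eq_AB mul1r subrr.
rewrite /smax; case: ifP => [le_PQ|/negbT nle_PQ].
  by apply: syz_combine (esym eq_PQ) _; rewrite // /olt /strict ne_sig.
apply: syz_combine eq_PQ _ => //.
by rewrite /olt to_ltNge //; apply: ole_total.
Qed.

(** Multiplied by [m1 m2], the cross products compared by [pltp] and [similar] become [a1 s] and
    [a2 s], because both multiples are signed [s]. *)
Lemma pltp_same_sig m1 p1 m2 p2 s a1 a2 :
  sig (mvalue (m1, p1)) = Some s -> sig (mvalue (m2, p2)) = Some s ->
  lm (mvalue (m1, p1)) = Some a1 -> lm (mvalue (m2, p2)) = Some a2 ->
  pltp p1 p2 = strict leM a1 a2 /\ similar p1 p2 = (a1 == a2).
Proof.
rewrite !lm_mvalue !sig_mvalue /Defs.pltp /Defs.similar.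
case: (sig p1) => [t1|] //= [s1]; case: (sig p2) => [t2|] //= [s2].
case: (lm p1) => [b1|] //= [<-]; case: (lm p2) => [b2|] //= [<-].
have E1 : smul (m1 + b1)%MM s = smul (m1 + m2)%MM (smul b1 t2).
  by rewrite -s2 !smulA -!addmA [(m2 + b1)%MM]addmC.
have E2 : smul (m2 + b2)%MM s = smul (m1 + m2)%MM (smul b2 t1).
  by rewrite -s1 !smulA [in LHS]addmC addmA.
split; first by rewrite -(ltS_mul2r s) E1 E2 ltS_mul2l.
apply/eqP/eqP => [/Some_inj eq_b|eq_a].
  by apply: (@smulIr s); rewrite E1 E2 eq_b.
by congr Some; apply: (@smulI (m1 + m2)%MM); rewrite -E1 -E2 eq_a.
Qed.

(** A competitor refuting the M-pair condition. In this existential form the property persists when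
    DONE grows, so the invariant can keep it. *)
Definition beaten D x : Prop :=
  exists y, [/\ y.2 \in D, msig leS y = msig leS x, y.1 != 0%MM,
    ~~ equivalent leM leS y.2 x.2 &
    ~ (pltp x.2 y.2 \/ (similar x.2 y.2 /\ olt leS (sig y.2) (sig x.2)))].

Lemma not_Mpair_beaten D x : x.2 \in D -> x.1 != 0%MM ->
  ~ Mpair leM leS D x -> beaten D x.
Proof.
move=> xD x_nz not_M; apply: NNPP => not_beaten; apply: not_M; split=> //.
move=> y yD sig_y y_nz ne_y; apply: NNPP => no; apply: not_beaten.
by exists y.
Qed.

(** [inv_Jpair] records the fate of each J-pair of DONE: waiting, covered, or beaten. Multiplier 1
    is left out because the value is then an element of DONE, which is least by [inv_least]. The
    last field is the theorem itself. *)
Record invariant S : Prop := Invariant {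
  inv_least : forall q, q \in done_of S -> least q;
  inv_sig : forall q, q \in done_of S -> sig q != None;
  inv_todo : forall x, x \in todo_of S -> is_pair x.2 /\ sig x.2 != None;
  inv_init : forall i, (0%MM, initial_pair f i) \in todo_of S \/
    covered (done_of S) (Some (0%MM, i));
  inv_Jpair : forall q r a b, q \in done_of S -> r \in done_of S ->
    lm q = Some a -> lm r = Some b -> pltp q r ->
    let x := ((mlcm a b - a)%MM, q) in x.1 != 0%MM ->
    [\/ x \in todo_of S, covered (done_of S) (msig leS x)
      | beaten (done_of S) x];
  inv_TRB : forall q, q \in done_of S ->
    syz (sig q) \/ TRB_signature leM leS f (sig q)
}.

Lemma inv_pair S q : invariant S -> q \in done_of S -> is_pair q.
Proof. by move=> IS /(inv_least IS)[]. Qed.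

(* Take the multiple [cq] signed [s] with least leading monomial, and among
   those the least [c].  If it were reducible by [r] in DONE, the J-pair of [q]
   and [r] would give either a better multiple or, when it is [c, q] itself, a
   processed J-pair that no M-pair beats. *)
Lemma covered_below S s : invariant S ->
  (forall x, x \in todo_of S -> olt leS (Some s) (msig leS x)) ->
  covered (done_of S) (Some s).
Proof.
move=> IS; move: s; apply: ltS_ind => s IH below.
have cov t : strict leS t s -> covered (done_of S) (Some t).
  move=> lt_ts; apply: IH => // x /below.
  by move/(to_ltW); apply: (to_lt_le_trans (ole_total totS) (y := Some s)).
have [|not_syz] := classic (syz (Some s)); first by left.
have lm_some p : is_pair p -> sig p = Some s -> exists a, lm p = Some a.
  move=> pp sig_p; case lm_p: (lm p) => [a|]; first by exists a.
  by case: not_syz; exists p; rewrite /syzygy lm_p.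
pose cand c q := q \in done_of S /\ sig (mvalue (c, q)) = Some s.
have cand_pair c q : cand c q -> is_pair (mvalue (c, q)).
  by case=> qD _; apply/pair_mvalue/(inv_pair IS).
have [c0 [q0 cand0]] : exists c q, cand c q.
  have sE : s = smul s.1 (0%MM, s.2) by case: (s) => m i;
    rewrite /smul /= addm0.
  case: (inv_init IS s.2) => [/below|[|[c [q [qD sig_q _]]]]].
  - rewrite /msig mvalue0 sig_initial /olt to_ltNge; last exact: ole_total.
    move/negP; case; rewrite /= [X in leS _ X]sE -[X in leS X _]smul0.
    by rewrite leS_mul2r dvd_leM //; apply/mnm_lepP => k; rewrite mnm0E.
  - by move/(syz_smul s.1); rewrite -sE.
  - exists (s.1 + c)%MM, q; split=> //.
    by rewrite -mvalueD sig_mvalue sig_q /= -sE.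
have [a0 lm0] := lm_some _ (cand_pair _ _ cand0) (proj2 cand0).
have [a [[c1 [q1 [cand1 lm1]]] min_a]] := leM_min
  (P := fun a => exists c q, cand c q /\ lm (mvalue (c, q)) = Some a)
  (ex_intro _ a0 (ex_intro _ c0 (ex_intro _ q0 (conj cand0 lm0)))).
have [c [[q [cand_q lm_cq]] min_c]] := leM_min
  (P := fun c => exists q, cand c q /\ lm (mvalue (c, q)) = Some a)
  (ex_intro _ c1 (ex_intro _ q1 (conj cand1 lm1))).
have [qD sig_cq] := cand_q.
have [lcq|not_least] := classic (least (mvalue (c, q))).
  by right; exists c, q.
have [r [rD red_r]] : exists r, r \in done_of S /\ top_reducible leM leS
  (mvalue (c, q)) r.
  apply: NNPP => irr; apply: not_least.
  apply: (irreducible_least _ (cand_pair _ _ cand_q) sig_cq cov) => [g|g gD].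
    exact: inv_pair.
  by apply/negP => red; apply: irr; exists g.
have pr := inv_pair IS rD.
have /(top_reducibleP lm_cq sig_cq pr)[b [t [c' [lm_r sig_r aE lt_s]]]] :=
  red_r.
have [a1 lm_q aE'] : exists2 a1, lm q = Some a1 & a = (c + a1)%MM.
  by move: lm_cq; rewrite lm_mvalue; case: (lm q) => [a1|] //= [<-]; exists a1.
have [u sig_q sE] : exists2 u, sig q = Some u & s = smul c u.
  by move: sig_cq; rewrite sig_mvalue; case: (sig q) => [u|] //= [<-]; exists u.
(* Multiplied by [c], the inequality compares [b c' t] with [b s]. *)
have lt_qr : pltp q r.
  rewrite /Defs.pltp lm_q lm_r sig_q sig_r.
  rewrite -[olt _ _ _]/(strict leS (smul a1 t) (smul b u)) -(ltS_mul2l c).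
  by rewrite smulA -aE' aE [smul c _]smulCA -sE addmC -smulA ltS_mul2l.
have c_nz : c != 0%MM.
  by apply: contra_not_neq not_least => ->; rewrite mvalue0;
    apply: (inv_least IS).
(* [a] is a common multiple of [a1] and [b], so the J-pair multiplier [m] divides [c], with cofactor
   [e]. *)
set m := (mlcm a1 b - a1)%MM.
have mE : (m + a1)%MM = mlcm a1 b by rewrite submK // lem_mlcml.
have dvd_a : (mlcm a1 b <= a)%MM by rewrite lem_mlcm {1}aE' {1}aE !lem_addl.
pose e := (a - mlcm a1 b)%MM.
have cE : c = (e + m)%MM.
  by apply: (@addIm _ a1); rewrite -addmA mE submK // -aE'.
have [m_eq|m_ne] := eqVneq m c.
  have := inv_Jpair IS qD rD lm_q lm_r lt_qr; rewrite -/m m_eq => /(_ c_nz).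
  case=> [/below||[[c2 q2] /= [q2D sig2 c2_nz ne2 nlt2]]].
  - by rewrite /msig sig_cq /olt /strict eqxx.
  - by rewrite /msig sig_cq.
  case: nlt2; rewrite /msig /= in sig2; rewrite sig_cq in sig2.
  have cand2 : cand c2 q2 by [].
  have [a2 lm2] := lm_some _ (cand_pair _ _ cand2) sig2.
  have [-> ->] := pltp_same_sig sig_cq sig2 lm_cq lm2.
  (* Minimality of [a] leaves only the similar case [a = a2] to settle. There [c] is at most [c2]:
     equality would make [q] and [q2] equivalent, and otherwise [c u = c2 u2] puts [u2] below
     [u]. *)
  have le_a : leM a a2 by apply: min_a; exists c2, q2.
  rewrite /strict le_a andbT; have [eq_a|] := eqVneq a a2; last by left.
  right; split=> //; rewrite -eq_a in lm2.
  have le_c : leM c c2 by apply: min_c; exists q2.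
  move: sig2 lm2; rewrite sig_mvalue lm_mvalue sig_q.
  case sig2: (sig q2) => [u2|] //= [s2E]; case lm2: (lm q2) => [b2|] //= [a2E].
  have [eq_c|ne_c] := eqVneq c c2.
    case/negP: ne2; rewrite /equivalent sig2 lm2 sig_q lm_q; apply/andP; split.
      by apply/eqP; congr Some; apply: (@smulI c); rewrite {1}eq_c s2E.
    by apply/eqP; congr Some; apply: (@addmI _ c); rewrite {1}eq_c a2E.
  rewrite -[olt _ _ _]/(strict leS u2 u) -(ltS_mul2l c) -sE -s2E ltS_mul2r.
  by rewrite /strict ne_c.
(* Now the J-pair is signed [s'] below [s], so [s'] is covered by induction. As [r] reduces [mq], a
   least pair signed [s'] has leading monomial below [m a1]; multiplied by [e], it contradicts the
   choice of [a]. *)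
have e_nz : e != 0%MM by apply: contra_neq m_ne => e0; rewrite cE e0 add0m.
pose s' := smul m u.
have s_s' : s = smul e s' by rewrite sE cE smulA.
have lt_s' : strict leS s' s by rewrite s_s'; apply: ltS_mul.
have sig_mq : sig (mvalue (m, q)) = Some s' by rewrite sig_mvalue sig_q.
have lm_mq : lm (mvalue (m, q)) = Some (m + a1)%MM by rewrite lm_mvalue lm_q.
have pmq : is_pair (mvalue (m, q)) by apply/pair_mvalue/(inv_pair IS).
have red_mq : top_reducible leM leS (mvalue (m, q)) r.
  apply/(top_reducibleP lm_mq sig_mq pr); exists b, t, (mlcm a1 b - b)%MM.
  have bE : (mlcm a1 b - b + b)%MM = mlcm a1 b by rewrite submK // lem_mlcmr.
  split=> //; first by rewrite bE.
  rewrite -(ltS_mul2l e) -s_s' smulA.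
  suff -> : (e + (mlcm a1 b - b))%MM = c' by [].
  by apply: (@addIm _ b); rewrite -addmA bE -aE submK.
case: (cov s' lt_s') => [/(syz_smul e)|[c2 [q2 [q2D sig2 l2]]]].
  by rewrite -s_s'.
have [pr' sig_r' lt_r'] := top_reduceP pmq pr red_mq.
have := l2.2 _ pr'; rewrite sig_r' sig_mq sig2 => /(_ erefl) le2.
have := ole_olt_trans le2 lt_r'; rewrite lm_mq.
have cand2 : cand (e + c2)%MM q2.
  by split=> //; rewrite -mvalueD sig_mvalue sig2 s_s'.
have [a2 lm2] := lm_some _ (cand_pair _ _ cand2) (proj2 cand2).
move: (lm2); rewrite -mvalueD lm_mvalue; case: (lm _) => [a3|] //= [a2E].
rewrite -[olt _ _ _]/(strict leM a3 (m + a1)%MM) -(ltM_add2l e) a2E.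
rewrite addmA -cE -aE' to_ltNge //.
by rewrite min_a //; exists (e + c2)%MM, q2.
Qed.

(** * Pairs produced by top reductions *)

Lemma top_redsP D p p' : (forall q, q \in D -> is_pair q) -> is_pair p ->
  top_reds leM leS D p p' ->
  [/\ is_pair p', sig p' = sig p, p' = p \/ olt leM (lm p') (lm p)
    & forall q, q \in D -> ~~ top_reducible leM leS p' q].
Proof.
move=> pD pp red; elim: red pp => {p p'} [p irr|p q p' qD red _ IH] pp.
  by split=> //; left.
have [pr sig_r lt_r] := top_reduceP pp (pD _ qD) red.
have [pp' sig_p' lm_p' irr] := IH pr.
split=> //; [by rewrite sig_p' | right].
case: lm_p' => [-> //|lt_p']; apply: ole_olt_trans lt_r; exact: to_ltW lt_p'.
Qed.

Lemma reduct_least S x p' : invariant S -> selectable leS S x ->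
  top_reds leM leS (done_of S) (mvalue x) p' ->
  [/\ least p', sig p' = msig leS x, sig p' != None
    & p' = mvalue x \/ olt leM (lm p') (lm (mvalue x))].
Proof.
move=> IS [xT min_x] red; have [px sig_x] := inv_todo IS xT.
have pD := fun q => @inv_pair S q IS.
have [pp' sig_p' lm_p' irr] := top_redsP pD (pair_mvalue px) red.
have {}sig_x : sig p' != None.
  rewrite sig_p'; case: (x) sig_x => m q /=.
  by rewrite sig_mvalue; case: (sig q).
split=> //; case sig_s: (sig p') sig_x => [s|] // _.
apply: (irreducible_least pD pp' sig_s _ irr) => t lt_ts.
apply: covered_below => // y /min_x.
apply: (to_lt_le_trans (ole_total totS)).
by rewrite /msig -sig_p' sig_s.
Qed.

Lemma covered_self D p : p \in D -> least p -> covered D (sig p).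
Proof. by move=> pD lp; right; exists 0%MM, p; rewrite mvalue0. Qed.

(** Only [E_i] itself divides [E_i], so no signature divides it properly. *)
Lemma TRB_initial p i : least p -> sig p = Some (0%MM, i) ->
  syz (sig p) \/ TRB_signature leM leS f (sig p).
Proof.
move=> lp sig_p; have [syz_p|nsyz] := boolP (syzygy leM p).
  by left; exists p; split=> //; case: lp.
right; exists p; split=> //; split=> [|q _]; first exact: least_TRP.
rewrite sig_p; case: (sig q) => [[m j]|] //=;
  apply/negP => /andP[/andP[/= /eqP -> m0]].
case/eqP; congr (Some (_, _)); apply/mnmP => k; move/mnm_lepP/(_ k): m0.
by rewrite mnm0E leqn0 => /eqP.
Qed.

(* A TRP pair similar to [p'] with smaller signature is covered by a multiple of
   an element of DONE, which the M-pair [x] beats, so [lm p'] could not have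
   dropped below [lm (mvalue x)]. *)
Lemma TRB_Mpair S x p' : invariant S -> selectable leS S x ->
  Mpair leM leS (done_of S) x -> least p' -> sig p' = msig leS x ->
  olt leM (lm p') (lm (mvalue x)) ->
  syz (sig p') \/ TRB_signature leM leS f (sig p').
Proof.
case: x => m p IS [xT min_x] [/= pD m_nz Mx] lp' sig_p' lt_p'.
have [syz_p|nsyz] := boolP (syzygy leM p').
  by left; exists p'; split=> //; case: lp'.
right; exists p'; split=> //; split=> [|q [[pq nsyz_q _] sim]];
  first exact: least_TRP.
move: nsyz nsyz_q; rewrite /syzygy.
case lm_p': (lm p') lt_p' => [a|] // lt_p' _.
case lm_q: (lm q) => [b|] // _; apply/negP.
move: sim; rewrite /Defs.similar lm_p' lm_q.
have := sig_neq_None pq; rewrite lm_q => /(_ isT).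
case sig_q: (sig q) => [t|] // _.
case sig_s: (sig p') => [s|] //= /eqP/Some_inj sim /andP[/andP[/eqP eq_i dvd]
  ne_ts].
set e := (s.1 - t.1)%MM.
have sE : s = smul e t by rewrite /smul submK // eq_i -surjective_pairing.
have e_nz : e != 0%MM by apply: contra_neq ne_ts => e0; rewrite sE e0 smul0.
have lt_ts : strict leS t s by rewrite sE; apply: ltS_mul.
have aE : a = (e + b)%MM.
  by apply: (@smulIr t); rewrite -sim sE smulA addmC.
have sig_x : sig (mvalue (m, p)) = Some s by rewrite -sig_s sig_p'.
have : covered (done_of S) (Some t).
  apply: covered_below => // y /min_x.
  by apply: (to_lt_le_trans (ole_total totS)); rewrite /msig sig_x.
case=> [[z [pz /eqP lm_z sig_z]]|[c [r [rD sig_r lr]]]].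
  (* The multiple [ez] would be a syzygy pair signed [s], against the leastness of the non-syzygy
     pair [p']. *)
  have [ps' min_p'] := lp'.
  have := min_p' _ (@pair_mvalue (e, z) pz); rewrite lm_mvalue sig_mvalue.
  by rewrite lm_z sig_z lm_p' sig_s /= -sE => /(_ erefl).
have le_rq : ole leM (lm (mvalue (c, r))) (Some b).
  by rewrite -lm_q; apply: lr.2 => //; rewrite sig_q.
case lm_cr: (lm (mvalue (c, r))) le_rq => [b'|] // le_b'; last first.
  have [ps' min_p'] := lp'.
  have := min_p' _ (@pair_mvalue (e, mvalue (c, r)) (proj1 lr)).
  by rewrite lm_mvalue sig_mvalue lm_cr sig_r lm_p' sig_s /= -sE => /(_ erefl).
pose y := ((e + c)%MM, r).
have sig_y : sig (mvalue y) = Some s by rewrite -mvalueD sig_mvalue sig_r sE.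
have lm_y : lm (mvalue y) = Some (e + b')%MM
  by rewrite -mvalueD lm_mvalue lm_cr.
have y_nz : y.1 != 0%MM by rewrite mnmD_eq0 negb_and e_nz.
have le_ya : leM (e + b')%MM a by rewrite aE leM_add2l.
case lm_x: (lm (mvalue (m, p))) lt_p' => [a'|]; last by [].
rewrite -[olt _ _ _]/(strict leM a a') to_ltNge // => /negP; apply.
apply: to_trans le_ya => //.
(* It remains to bound the leading monomial of [mp] by that of the value of [y]. If [r] and [p] are
   equivalent, the common signature [s] forces [m = e c] and the two agree; otherwise [y] is a
   competitor and the M-pair condition applies. *)
have [|ne] := boolP (equivalent leM leS r p).
  case/andP => /eqP sig_rp /eqP lm_rp.
  move: sig_x sig_y lm_x lm_y; rewrite !sig_mvalue !lm_mvalue /= sig_rp lm_rp.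
  case: (sig p) => [u|] //= /Some_inj <- /Some_inj/smulIr -> -> /Some_inj ->;
    exact: to_refl.
have [lt_xy sim_xy] := pltp_same_sig sig_x sig_y lm_x lm_y.
have := Mx y rD _ y_nz ne; rewrite /msig sig_y sig_x => /(_ erefl) /=.
rewrite lt_xy sim_xy => -[/(to_ltW) //|[/eqP -> _]]; exact: to_refl.
Qed.

(** * Preservation of the invariant *)

Lemma invariant_init : invariant (init_state f).
Proof.
split=> //=.
- by move=> x /imfsetP[i _ ->] /=; split;
  [exact: pair_initial | rewrite sig_initial].
- by move=> i; left; apply: in_imfset.
Qed.

(** The last two hypotheses are the debts left by removing [x]: one if it was initial, the other if
    it was a J-pair of DONE. *)
Lemma invariant_drop S x : invariant S -> x \in todo_of S ->
  (forall i, x = (0%MM, initial_pair f i) ->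
    covered (done_of S) (Some (0%MM, i))) ->
  (x.2 \in done_of S -> x.1 != 0%MM ->
     covered (done_of S) (msig leS x) \/ beaten (done_of S) x) ->
  invariant (State (done_of S) (todo_of S `\ x)).
Proof.
move=> IS xT init_x J_x; split=> /=.
- exact: inv_least.
- exact: inv_sig.
- by move=> y; rewrite !inE => /andP[_ /(inv_todo IS)].
- move=> i; case: (inv_init IS i) => [iT|]; last by right.
  have [eq_x|ne_x] := eqVneq (0%MM, initial_pair f i) x.
    by right; apply: init_x.
  by left; rewrite !inE ne_x.
- move=> q r a b qD rD lm_q lm_r lt_qr m_nz.
  have [eq_x|ne_x] := eqVneq ((mlcm a b - a)%MM, q) x.
    by have := J_x; rewrite -eq_x => /(_ qD m_nz)[];
      [constructor 2 | constructor 3].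
  case: (inv_Jpair IS qD rD lm_q lm_r lt_qr m_nz) => H.
  + by constructor 1; rewrite !inE ne_x.
  + by constructor 2.
  + by constructor 3.
- exact: inv_TRB.
Qed.

Lemma beaten_sub D D' x : {subset D <= D'} -> beaten D x -> beaten D' x.
Proof. by move=> sub [y [yD *]]; exists y; split=> //; apply: sub. Qed.

Lemma Jpair_l q r a b : lm q = Some a -> lm r = Some b -> pltp q r ->
  Jpair leM leS q r = Some ((mlcm a b - a)%MM, q).
Proof.
move=> lm_q lm_r lt_qr; rewrite /Jpair lm_q lm_r lt_qr.
by rewrite /Defs.similar; case/andP: (lt_qr) => /negPf ->.
Qed.

(** [new_Jpairs] always passes the new pair first, whereas the smaller pair for [pltp] may be either
    one; hence this companion of [Jpair_l]. *)
Lemma Jpair_r q r a b : lm q = Some a -> lm r = Some b -> pltp q r ->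
  Jpair leM leS r q = Some ((mlcm a b - a)%MM, q).
Proof.
move=> lm_q lm_r lt_qr; rewrite /Jpair lm_q lm_r mlcmC /Defs.similar eq_sym.
case/andP: (lt_qr) => /negPf -> _; case: ifP => // lt_rq.
by move: lt_qr; rewrite /Defs.pltp /olt to_ltNge ?(to_ltW lt_rq) //;
  apply: ole_total.
Qed.

Lemma Jpair_mem p q x : Jpair leM leS p q = Some x -> x.2 = p \/ x.2 = q.
Proof.
rewrite /Jpair; case: (lm p) => [a|] //; case: (lm q) => [b|] //.
by case: ifP => // _; case: ifP => _ [<-]; [left | right].
Qed.

Lemma mem_new_Jpairs D p q x : q \in D -> Jpair leM leS p q = Some x ->
  x \in new_Jpairs leM leS D p.
Proof. by move=> qD Jx; rewrite in_fset mem_pmap -Jx; apply: map_f. Qed.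

Lemma invariant_store S x p' : invariant S -> x \in todo_of S ->
  least p' -> sig p' = msig leS x -> sig p' != None ->
  syz (sig p') \/ TRB_signature leM leS f (sig p') ->
  invariant (State (p' |` done_of S)
                   ((todo_of S `\ x) `|` new_Jpairs leM leS (done_of S) p')).
Proof.
move=> IS xT lp' sig_p' sig_nz TRB_p'.
set D' := p' |` done_of S.
have sub : {subset done_of S <= D'} by move=> q qD; rewrite !inE qD orbT.
have p'D : p' \in D' by rewrite !inE eqxx.
have cov_x : covered D' (msig leS x) by rewrite -sig_p'; apply: covered_self.
have least' q : q \in D' -> least q.
  by rewrite !inE => /predU1P[-> //|]; apply: inv_least.
have sig' q : q \in D' -> sig q != None.
  by rewrite !inE => /predU1P[-> //|]; apply: inv_sig.
split=> //=.
- move=> y; rewrite !inE => /orP[/andP[_ /(inv_todo IS)] //|].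
  rewrite mem_pmap => /mapP[q qD /esym Jy].
  have yD : y.2 \in D' by case: (Jpair_mem Jy) => -> //; apply: sub.
  by split; [case: (least' _ yD) | apply: sig'].
- move=> i; case: (inv_init IS i) => [iT|]; last by right;
  apply: covered_sub sub _.
  have [eq_x|ne_x] := eqVneq (0%MM, initial_pair f i) x; last by left;
    rewrite !inE ne_x iT.
  by right; move: cov_x; rewrite -eq_x /msig mvalue0 sig_initial.
- move=> q r a b /fset1UP[->|qD] /fset1UP[->|rD] lm_q lm_r lt_qr m_nz.
  + by move: lt_qr; rewrite /Defs.pltp /olt /strict eqxx.
  + constructor 1; rewrite in_fsetU (mem_new_Jpairs rD) ?orbT //.
    exact: Jpair_l.
  + constructor 1; rewrite in_fsetU (mem_new_Jpairs qD) ?orbT //.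
    exact: Jpair_r.
  have [eq_x|ne_x] := eqVneq ((mlcm a b - a)%MM, q) x.
    by constructor 2; rewrite eq_x.
  case: (inv_Jpair IS qD rD lm_q lm_r lt_qr m_nz) => H.
  + by constructor 1; rewrite !inE ne_x H.
  + by constructor 2; apply: covered_sub H.
  + by constructor 3; apply: beaten_sub H.
- by move=> q; rewrite !inE => /predU1P[-> //|]; apply: inv_TRB.
Qed.

Lemma invariant_step S S' : invariant S -> step leM leS f S S' -> invariant S'.
Proof.
move=> IS; case=> [x [xT _] crit | x p' sel _ red [not_init eq_p']
                  | x p' sel not_crit red not_store].
- have syz_x : GSyzygy_criterion leM leS (done_of S) x -> syz (msig leS x).
    by apply: GSyzygy_syz => q; apply: inv_pair.
  apply: invariant_drop => // [i x_init | xD x_nz].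
    (* An initial multiplied pair can only be rejected by the syzygy criterion. *)
    case: crit => [/syz_x|[]]; last by case; rewrite x_init; split=> //;
      exists i.
    by rewrite x_init /msig mvalue0 sig_initial; left.
  by case: crit => [/syz_x|[_ /(not_Mpair_beaten xD x_nz)]]; [left;
    left | right].
- have [lp' sig_p' _ lm_p'] := reduct_least IS sel red.
  have [_ /eqP eq_lm] := andP eq_p'.
  (* Equal leading monomials exclude any actual reduction, so the multiple [mp] is itself least and
     covers its signature when [p] is in DONE. *)
  have {}lm_p' : p' = mvalue x.
    by case: lm_p' => //; rewrite eq_lm /olt /strict eqxx.
  apply: invariant_drop => // [|i x_init | xD _]; first by case: sel.
    by case: not_init; exists i; rewrite lm_p' x_init mvalue0.
  left; right; case: x lm_p' xD {sel red eq_p' sig_p' eq_lm} => m q p'E qD.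
  by exists m, q; split=> //; rewrite -p'E.
have [lp' sig_p' sig_nz lm_p'] := reduct_least IS sel red.
apply: invariant_store => //; first by case: sel.
have [[x0 [i x_init]]|not_init_x] := classic (initial_mpair f x).
  apply: (@TRB_initial _ i) => //; rewrite sig_p' /msig;
    case: (x) x0 x_init => m q /= -> ->.
  by rewrite mvalue0 sig_initial.
have [[i p'E]|not_init] := classic (initial f p').
  by apply: (@TRB_initial _ i) => //; rewrite p'E sig_initial.
have Mx : Mpair leM leS (done_of S) x.
  by apply: NNPP => nMx; apply: not_crit; right.
apply: (TRB_Mpair IS sel Mx lp' sig_p').
(* Stored without being initial, [p'] is not equivalent to [mp], so a reduction did take place. *)
case: lm_p' => // p'E; case: not_store; split=> //.
by rewrite p'E /equivalent !eqxx.
Qed.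

End SignatureTheory.

Theorem proposition16 (K : fieldType) (n d : nat)
  (leM : rel 'X_{1..n}) (leS : rel (smon n d))
  (hM : admissible_mon leM) (hS : admissible_smon leS)
  (hMS : compatible leM leS)
  (f : 'rV[{mpoly K[n]}]_d)
  (S : state K n d) (hreach : reachable leM leS f S)
  (p : pairT K n d) (hp : p \in done_of S) :
  syzygy_signature leM leS f (sig leS p) \/ TRB_signature leM leS f (sig leS p).
Proof.
suff IS : invariant leM leS f S by apply: inv_TRB hp.
elim: hreach => [|S1 S2 _ IS1 S12]; first exact: invariant_init.
exact: invariant_step IS1 S12.
Qed.
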